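(* Let $\ell, m \geq 2$ be integers. Then $\operatorname{cPol} B_\ell \subseteq \operatorname{cPol} B_m$ if and only if $m$ divides $\ell$.
   Context: Let $\mathbb{B} = \{0,1\}$. A Boolean function is a map $f\colon \mathbb{B}^n \to \mathbb{B}$ with $n \ge 1$. An $m$-ary relational constraint is a pair $(R,S)$ with $R,S\subseteq\mathbb{B}^m$. A function $f\colon\mathbb{B}^n\to\mathbb{B}$ preserves $(R,S)$ if for all $\mathbf{a}^1,\dots,\mathbf{a}^n\in R$ the tuple $f(\mathbf{a}^1,\dots,\mathbf{a}^n)$, whose $i$-th entry is $f(a^1_i,\dots,a^n_i)$, lies in $S$. For a relational constraint $Q$, $\operatorname{cPol} Q$ is the set of all Boolean functions (of all arities) preserving $Q$. For $n\ge1$, $B_n$ is the $2n$-ary relational constraint $(R(B_n),S(B_n))$ with $R(B_n)=\{(x_1,\dots,x_{2n})\in\mathbb{B}^{2n}: \sum_{i=1}^n x_i=\sum_{i=n+1}^{2n}x_i\}$ (sums in $\mathbb{R}$) and $S(B_n)=\mathbb{B}^{2n}\setminus\{(0,\dots,0,1,\dots,1),(1,\dots,1,0,\dots,0)\}$ (each block of length $n$). *)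

(* Defs.v *)
From mathcomp Require Import all_boot.
Set Implicit Arguments.
Unset Strict Implicit.
Unset Printing Implicit Defensive.

Record boolfun := BoolFun {
  arity : nat;
  arity_gt0 : 0 < arity;
  bf_fun :> arity.-tuple bool -> bool
}.

Record rconstraint (m : nat) := RConstraint {
  rc_R : {set m.-tuple bool};
  rc_S : {set m.-tuple bool}
}.

Definition bf_app (m : nat) (f : boolfun)
    (a : (arity f).-tuple (m.-tuple bool)) : m.-tuple bool :=
  [tuple f [tuple tnth (tnth a j) i | j < arity f] | i < m].

Definition preserves (m : nat) (f : boolfun) (Q : rconstraint m) : bool :=
  [forall a : (arity f).-tuple (m.-tuple bool),
    [forall j, tnth a j \in rc_R Q] ==> (bf_app a \in rc_S Q)].

Definition cPol (m : nat) (Q : rconstraint m) : pred boolfun :=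
  fun f => preserves f Q.

(* The entries are summed in nat through the coercion bool >-> nat, which
   agrees with the sums in the reals. The arity 2n is written n + n, so that
   lshift and rshift index the two blocks of length n. *)
Definition B (n : nat) : rconstraint (n + n) :=
  RConstraint
    [set x : (n + n).-tuple bool |
      \sum_(i < n) tnth x (lshift n i) == \sum_(i < n) tnth x (rshift n i)]
    (~: [set [tuple of nseq n false ++ nseq n true];
             [tuple of nseq n true ++ nseq n false]]).

(* Main.v *)
Require Import Defs.
From mathcomp Require Import all_boot.
From mathcomp Require Import order ssralg ssrnum ssrint zify.

Set Implicit Arguments.
Unset Strict Implicit.
Unset Printing Implicit Defensive.

(** Unfolding the definition, [f] preserves [B n] iff no [n] true points and [n]
    false points of [f] (with repetitions) have the same sum.  Repeating such a
    pair of families turns a violation of [B m] into one of [B (d * m)].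

    Conversely, view the points of the cube of dimension [m * m] as 0/1 matrices.
    The [m] row indicators and the [m] column indicators have the same sum, and
    the affine hull of these [2 m] points meets the cube in no other point.  Let
    [f] be true on the rows, false on the columns, and decide all other points by
    the sign of the first non-vanishing one among affine forms that cut out this
    affine hull.  If [l] true points and [l] false points have the same sum [S],
    all the forms vanish on them, so they are rows and columns respectively.
    Hence all entries of [S] equal some [s], and counting ones gives
    [m * m * s = l * m], so [m] divides [l]. *)

Import Order.TTheory GRing.Theory Num.Theory.

(** * Preservation of [B n], and the divisible case *)

Lemma preserves_BP (n : nat) (f : boolfun) :
  reflect (forall x y : 'I_n -> (arity f).-tuple bool,
             (forall c, \sum_i tnth (x i) c = \sum_i tnth (y i) c) ->
             (forall i, f (x i)) -> (forall i, ~~ f (y i)) -> False)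
          (preserves f (B n)).
Proof.
pose point (a : (arity f).-tuple ((n + n).-tuple bool)) k :=
  [tuple tnth (tnth a j) k | j < arity f].
have appE a k : tnth (bf_app a) k = f (point a k) by rewrite tnth_mktuple.
have nthl b b' (k : 'I_n) :
    tnth [tuple of nseq n b ++ nseq n b'] (lshift n k) = b.
  by rewrite (tnth_nth b) /= nth_cat size_nseq ltn_ord nth_nseq ltn_ord.
have nthr b b' (k : 'I_n) :
    tnth [tuple of nseq n b ++ nseq n b'] (rshift n k) = b'.
  rewrite (tnth_nth b) /= nth_cat size_nseq ltnNge leq_addr /= addKn.
  by rewrite nth_nseq ltn_ord.
have memR a c : (tnth a c \in rc_R (B n)) =
    (\sum_i tnth (point a (lshift n i)) c == \sum_i tnth (point a (rshift n i)) c).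
  by rewrite inE; congr (_ == _); apply: eq_bigr => i _; rewrite tnth_mktuple.
apply: (iffP forallP) => [Bf x y sumE fx fy|noviol a].
  (* The family [y] fills the first block, so that [bf_app a] becomes the excluded tuple of [n]
     zeros followed by [n] ones. *)
  pose a := [tuple [tuple match split k with
                          | inl i => tnth (y i) c
                          | inr i => tnth (x i) c
                          end | k < n + n] | c < arity f].
  have al i : point a (lshift n i) = y i.
    apply: eq_from_tnth => c; rewrite !tnth_mktuple.
    by rewrite -[lshift n i]/(unsplit (inl i)) unsplitK.
  have ar i : point a (rshift n i) = x i.
    apply: eq_from_tnth => c; rewrite !tnth_mktuple.
    by rewrite -[rshift n i]/(unsplit (inr i)) unsplitK.
  have Ra : [forall c, tnth a c \in rc_R (B n)].
    apply/forallP => c; rewrite memR.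
    under eq_bigr do rewrite al.
    by under [X in _ == X]eq_bigr do rewrite ar; rewrite sumE.
  have := Bf a; rewrite Ra !inE negb_or => /andP [/eqP + _]; apply.
  apply: eq_from_tnth => k; rewrite appE -(splitK k).
  case: (split k) => i /=; rewrite ?al ?ar ?nthl ?nthr; last exact: fx.
  exact/negbTE/fy.
apply/implyP => /forallP Ra.
have sumE c : \sum_i tnth (point a (lshift n i)) c
            = \sum_i tnth (point a (rshift n i)) c.
  by apply/eqP; rewrite -memR.
(* For either excluded tuple, the block of ones supplies the true points and the block of zeros the
   false ones. *)
rewrite !inE negb_or; apply/andP; split; apply/eqP => appa.
  apply: (noviol (fun i => point a (rshift n i)) (fun i => point a (lshift n i))).
  - by move=> c; rewrite sumE.
  - by move=> i; rewrite -appE appa nthr.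
  - by move=> i; rewrite -appE appa nthl.
apply: (noviol (fun i => point a (lshift n i)) (fun i => point a (rshift n i))).
- exact: sumE.
- by move=> i; rewrite -appE appa nthl.
- by move=> i; rewrite -appE appa nthr.
Qed.

Lemma cPol_B_dvd (l m : nat) : 0 < m -> m %| l -> {subset cPol (B l) <= cPol (B m)}.
Proof.
move=> m_gt0 /dvdnP [d ->] f /preserves_BP Bf.
apply/preserves_BP => x y sumE fx fy.
pose r (k : nat) : 'I_m := Ordinal (ltn_pmod k m_gt0).
have sum_r (g : 'I_m -> nat) : \sum_(k < d * m) g (r k) = d * \sum_i g i.
  rewrite -(big_mkord xpredT (g \o r)).
  elim: d {Bf} => [|d IHd]; first by rewrite big_nil.
  rewrite mulSnr (big_cat_nat (n := d * m)) ?leq_addr //= IHd mulSnr.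
  congr (_ + _); rewrite -{1}[d * m]add0n big_addn addKn big_mkord.
  apply: eq_bigr => i _; congr g; apply: val_inj.
  by rewrite /= addnC modnMDl modn_small.
apply: (Bf (fun k => x (r k)) (fun k => y (r k))) => [c|i|i] /=; [|exact: fx|exact: fy].
by rewrite (sum_r (fun i => tnth (x i) c)) (sum_r (fun i => tnth (y i) c)) sumE.
Qed.

(** * Lexicographic signs *)

Fixpoint lexpos (b : bool) (s : seq int) : bool :=
  if s is a :: s' then (0 < a)%R || (a == 0%R) && lexpos b s' else b.

Lemma lexpos0 (b : bool) (s : seq int) : all (pred1 0%R) s -> lexpos b s = b.
Proof. by elim: s => //= a s IHs /andP [/eqP -> /IHs ->]; rewrite ltxx eqxx. Qed.

(** The first form is nonnegative on every [x i] and nonpositive on every [y i]. Equal sums force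
    both sums, hence all terms, to vanish, and the remaining forms decide by induction. *)
Lemma lexpos_balanced (I : finType) (K : eqType) (T : Type) (s : seq K)
    (F : K -> T -> int) (b : pred T) (x y : I -> T) :
  (forall k, \sum_i F k (x i) = \sum_i F k (y i))%R ->
  (forall i, lexpos (b (x i)) [seq F k (x i) | k <- s]) ->
  (forall i, ~~ lexpos (b (y i)) [seq F k (y i) | k <- s]) ->
  [/\ forall k i, k \in s -> F k (x i) = 0%R /\ F k (y i) = 0%R,
      forall i, b (x i) & forall i, ~~ b (y i)].
Proof.
move=> sumE; elim: s => [|k s IHs] /= xpos ypos; first by split.
have x_ge0 i : (0 <= F k (x i))%R.
  by case/orP: (xpos i) => [/ltW | /andP [/eqP ->]].
have y_le0 i : (F k (y i) <= 0)%R.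
  by move: (ypos i); rewrite negb_or -leNgt => /andP [].
have sx0 : (\sum_i F k (x i) = 0)%R.
  apply: le_anti; rewrite sumr_ge0 // andbT sumE.
  by rewrite -oppr_ge0 -sumrN sumr_ge0 // => i _; rewrite oppr_ge0.
have x0 i : F k (x i) = 0%R.
  by move/eqP: sx0; rewrite psumr_eq0 // => /allP /(_ i (mem_index_enum i)) /eqP.
have y0 i : F k (y i) = 0%R.
  move: sx0; rewrite sumE => /eqP; rewrite -oppr_eq0 -sumrN psumr_eq0; last first.
    by move=> j _; rewrite oppr_ge0.
  by move=> /allP /(_ i (mem_index_enum i)); rewrite /= oppr_eq0 => /eqP.
have [||F0 bx by_] := IHs.
- by move=> i; move: (xpos i); rewrite x0 ltxx eqxx.
- by move=> i; move: (ypos i); rewrite y0 ltxx eqxx.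
split=> // k' i; rewrite inE => /orP [/eqP -> //|]; exact: F0.
Qed.

(** * The function on 0/1 matrices *)

Definition cell (m : nat) (z : #|{: 'I_m * 'I_m}|.-tuple bool) (i j : 'I_m) : bool :=
  tnth z (enum_rank (i, j)).

(* The form [None] counts ones; [Some (i, j, (k, l))] is a 2 x 2 alternating sum,
   and these vanish exactly on the matrices with entries [c_i + d_j]. *)
Definition hull_form (m : nat) (q : option ('I_m * 'I_m * ('I_m * 'I_m)))
    (z : #|{: 'I_m * 'I_m}|.-tuple bool) : int :=
  if q is Some (i, j, (k, l)) then
    ((cell z i j + cell z k l)%N%:Z - (cell z i l + cell z k j)%N%:Z)%R
  else ((\sum_p tnth z p)%N%:Z - m%:Z)%R.

Definition constant_rows (m : nat) (z : #|{: 'I_m * 'I_m}|.-tuple bool) : bool :=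
  [forall i, forall j, forall k, cell z i j == cell z i k].

(** All forms vanish on rows and columns alike; the default value [constant_rows z] is what tells
    them apart. *)
Definition grid_fun (m : nat) (z : #|{: 'I_m * 'I_m}|.-tuple bool) : bool :=
  lexpos (constant_rows z) [seq hull_form q z | q <- enum {: option _}].

Lemma sum_cell (m : nat) (z : #|{: 'I_m * 'I_m}|.-tuple bool) :
  \sum_p tnth z p = \sum_i \sum_j cell z i j.
Proof.
rewrite pair_bigA (reindex_onto (@enum_rank _) (@enum_val _ _)) /=; last first.
  by move=> p _; rewrite enum_valK.
by apply: eq_big => [p|[i j] _]; rewrite ?enum_rankK ?eqxx.
Qed.

Lemma constant_columns (m : nat) (z : #|{: 'I_m * 'I_m}|.-tuple bool) :
  (forall q, hull_form (Some q) z = 0%R) ->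
  ~~ constant_rows z -> forall i k j, cell z i j = cell z k j.
Proof.
move=> z0 /forallPn [i0 /forallPn [j0 /forallPn [j1 neq01]]].
(* Rows [i] and [k] have the same difference between columns [j] and [j']. A difference of 1 or -1
   determines both bits. *)
have col i k j j' : cell z i j != cell z i j' -> cell z k j = cell z i j.
  by have := z0 (i, j, (k, j')); rewrite /hull_form; do 4!case: (cell _ _ _).
suff col0 i j : cell z i j = cell z i0 j by move=> i k j; rewrite !col0.
(* Row [i0] takes both values, so its entry at [j] differs from the one at [j0] or at [j1]. *)
have [eq0|neq0] := eqVneq (cell z i0 j) (cell z i0 j0).
  by apply: (col _ _ _ j1); rewrite eq0.
exact: (col _ _ _ j0).
Qed.

(** The forms are affine and both families have [l] members, so the constant terms agree. *)
Lemma sum_hull_form (m l : nat) (x y : 'I_l -> #|{: 'I_m * 'I_m}|.-tuple bool) :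
  (forall p, \sum_i tnth (x i) p = \sum_i tnth (y i) p) ->
  forall q, (\sum_i hull_form q (x i) = \sum_i hull_form q (y i))%R.
Proof.
move=> sumE q.
have total : \sum_i \sum_p tnth (x i) p = \sum_i \sum_p tnth (y i) p.
  by rewrite exchange_big [RHS]exchange_big; apply: eq_bigr.
have cellE i j : \sum_t cell (x t) i j = \sum_t cell (y t) i j by exact: sumE.
have sumz (g : 'I_l -> nat) : (\sum_i (g i)%:Z = (\sum_i g i)%N%:Z)%R.
  by rewrite -natz natr_sum; apply: eq_bigr => i _; rewrite natz.
case: q => [[[i j] [k h]]|] /=; rewrite !sumrB !sumz; last by rewrite total.
by rewrite !big_split /= !cellE.
Qed.

Lemma grid_fun_balanced_dvd (m l : nat)
    (x y : 'I_l -> #|{: 'I_m * 'I_m}|.-tuple bool) :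
  0 < m ->
  (forall p, \sum_i tnth (x i) p = \sum_i tnth (y i) p) ->
  (forall i, grid_fun (x i)) -> (forall i, ~~ grid_fun (y i)) -> m %| l.
Proof.
move=> m_gt0 sumE fx fy.
have [F0 xrow ycol] := lexpos_balanced (sum_hull_form sumE) fx fy.
have {}ycol t : forall i k j, cell (y t) i j = cell (y t) k j.
  apply: constant_columns (ycol t) => q.
  by have [|] := F0 (Some q) t; rewrite ?mem_enum.
have {}xrow t i j k : cell (x t) i j = cell (x t) i k.
  by have /forallP/(_ i)/forallP/(_ j)/forallP/(_ k)/eqP := xrow t.
have xtotal t : \sum_p tnth (x t) p = m.
  have [|] := F0 None t; first by rewrite mem_enum.
  by rewrite /hull_form; lia.
pose o := Ordinal m_gt0; pose s := \sum_t cell (x t) o o.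
have cellE i j : \sum_t cell (x t) i j = s.
  (* The common sum is constant along rows because of [x], and along columns because of [y]. *)
  have -> : \sum_t cell (x t) i j = \sum_t cell (x t) i o.
    by apply: eq_bigr => t _; rewrite (xrow _ _ _ o).
  rewrite /s [LHS]sumE [RHS]sumE.
  by apply: eq_bigr => t _; rewrite -!/(cell _ _ _) (ycol _ _ o).
have : \sum_t \sum_p tnth (x t) p = m * (m * s).
  under eq_bigr => t _ do rewrite sum_cell.
  rewrite exchange_big /=.
  under eq_bigr => i _.
    rewrite exchange_big /=; under eq_bigr => j _ do rewrite cellE.
    by rewrite sum_nat_const card_ord; over.
  by rewrite sum_nat_const card_ord.
under eq_bigr => t _ do rewrite xtotal.
rewrite sum_nat_const card_ord mulnC => /eqP; rewrite eqn_pmul2l // => /eqP ->.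
exact: dvdn_mulr.
Qed.

Lemma grid_fun_hull (m : nat) (z : #|{: 'I_m * 'I_m}|.-tuple bool) :
  (forall q, hull_form q z = 0%R) -> grid_fun z = constant_rows z.
Proof. by move=> z0; apply/lexpos0/allP => _ /mapP [q _ ->]; rewrite /= z0. Qed.

(** * Row and column indicators *)

Definition of_cells (m : nat) (g : 'I_m -> 'I_m -> bool) :
    #|{: 'I_m * 'I_m}|.-tuple bool :=
  [tuple g (enum_val p).1 (enum_val p).2 | p < _].

Lemma cell_of_cells (m : nat) (g : 'I_m -> 'I_m -> bool) i j :
  cell (of_cells g) i j = g i j.
Proof. by rewrite /cell tnth_mktuple enum_rankK. Qed.

Lemma sum_of_cells (m : nat) (g : 'I_m -> 'I_m -> bool) :
  \sum_p tnth (of_cells g) p = \sum_i \sum_j g i j.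
Proof.
by rewrite sum_cell; do 2!apply: eq_bigr => ? _; rewrite cell_of_cells.
Qed.

Lemma sum_eq_ord (m : nat) (r : 'I_m) : \sum_i (i == r) = 1.
Proof.
by rewrite (bigD1 r) //= eqxx big1 // => i /negbTE ->.
Qed.

Lemma grid_fun_row (m : nat) (r : 'I_m) : grid_fun (of_cells (fun i _ => i == r)).
Proof.
rewrite grid_fun_hull => [|[[[i j] [k h]]|]] /=.
- by do 3!apply/forallP => ?; rewrite !cell_of_cells.
- by rewrite !cell_of_cells subrr.
rewrite sum_of_cells exchange_big /=.
under eq_bigr => i _ do rewrite sum_eq_ord.
by rewrite sum_nat_const card_ord muln1 subrr.
Qed.

Lemma grid_fun_column (m : nat) (r : 'I_m) :
  1 < m -> ~~ grid_fun (of_cells (fun _ j => j == r)).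
Proof.
move=> m_gt1; rewrite grid_fun_hull => [|[[[i j] [k h]]|]] /=.
(* If row [r] were constant, every index would equal [r], against [1 < m]. *)
- apply/negP => /forallP/(_ r)/forallP/(_ r) /forallP const_r.
  have := subset_leq_card (_ : [set: 'I_m] \subset [set r]).
  rewrite cardsT card_ord cards1 leqNgt m_gt1 => /(_ _)/notF; apply.
  apply/subsetP => j _; move: (const_r j).
  by rewrite !cell_of_cells eqxx inE => /eqP <-.
- by rewrite !cell_of_cells addnC subrr.
rewrite sum_of_cells.
under eq_bigr => i _ do rewrite sum_eq_ord.
by rewrite sum_nat_const card_ord muln1 subrr.
Qed.

Theorem proposition4p4 (l m : nat) (hl : 2 <= l) (hm : 2 <= m) :
  {subset cPol (B l) <= cPol (B m)} <-> m %| l.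
Proof.
have m_gt0 := ltnW hm.
split=> [sub|]; last exact: cPol_B_dvd.
have N_gt0 : 0 < #|{: 'I_m * 'I_m}| by rewrite card_prod card_ord muln_gt0 m_gt0.
pose f := BoolFun N_gt0 (@grid_fun m).
apply/negPn/negP => ndvd.
have /sub/preserves_BP : f \in cPol (B l).
  apply/preserves_BP => x y sumE fx fy; case/negP: ndvd.
  exact: grid_fun_balanced_dvd sumE fx fy.
apply; [|exact: grid_fun_row|by move=> r; exact: grid_fun_column].
(* Each cell lies in exactly one row and one column, so both sums are 1. *)
move=> p; under eq_bigr => r _ do rewrite tnth_mktuple eq_sym.
under [RHS]eq_bigr => r _ do rewrite tnth_mktuple eq_sym.
by rewrite !sum_eq_ord.
Qed.
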